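(* Let $\alpha,\beta\in L^\infty(\Omega,C\ell_{0,n})$ and let $h_0$ be a scalar (that is, real-valued) function on $\Omega$. Then $$\left(-\Delta+|\alpha|^2+|\beta|^2+\operatorname{div}\vec\alpha-\operatorname{div}\vec\beta+2\,\alpha\cdot\overline\beta\right)h_0=\mathrm{Sc}\,(D-\alpha C-\beta)(D-M^\alpha C-\overline\beta)h_0$$ and $$\left(-\Delta+|\alpha|^2+|\beta|^2+\operatorname{div}\vec\alpha+\operatorname{div}\vec\beta+2\,\alpha\cdot\beta\right)h_0=\mathrm{Sc}\,(D-M^\alpha C-\overline\beta)(D-\alpha C-\beta)h_0.$$
   Context: $\Omega\subset\mathbb{R}^n$ is a bounded domain with sufficiently smooth boundary. $C\ell_{0,n}$ is the real Clifford algebra generated by $e_1,\dots,e_n$ (with $e_0=1$) subject to $e_ie_j+e_je_i=-2\delta_{ij}$, with basis $e_A=e_{i_1}\cdots e_{i_k}$, $A=\{i_1<\dots<i_k\}\subseteq\{1,\dots,n\}$ ($e_\emptyset=1$). Conjugation $a\mapsto\overline a$ is the usual real-linear anti-automorphism with $\overline{ab}=\overline b\,\overline a$, $\overline 1=1$, $\overline{e_i}=-e_i$. $\mathrm{Sc}\,a$ is the coefficient of $1$ in $a$; $a\cdot b=\mathrm{Sc}(\overline a b)=\mathrm{Sc}(a\overline b)$ is the Euclidean scalar product of the coefficient vectors in $\mathbb{R}^{2^n}$, and $|a|^2=a\cdot a$. $L^\infty(\Omega,C\ell_{0,n})$ is the space of bounded $C\ell_{0,n}$-valued functions on $\Omega$.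 $\vec\alpha=\mathrm{Vec}\,\alpha=\sum_{i=1}^n\alpha_ie_i$ and $\vec\beta=\mathrm{Vec}\,\beta=\sum_{i=1}^n\beta_ie_i$ are the vector parts of $\alpha,\beta$, and $\operatorname{div}\vec\alpha=\sum_{i=1}^n\partial_i\alpha_i$. $\Delta$ is the Laplacian in $\mathbb{R}^n$. $D=\sum_{i=1}^n e_i\partial_i$ is the Moisil-Teodorescu operator, acting from the left; $C[w]=\overline w$; $M^\alpha[w]=w\alpha$ is multiplication by $\alpha$ on the right. Thus $(D-\alpha C-\beta)w=Dw-\alpha\overline w-\beta w$ and $(D-M^\alpha C-\overline\beta)w=Dw-\overline w\,\alpha-\overline\beta\,w$. *)

(* Defs.v *)
From HB Require Import structures.
From mathcomp Require Import all_boot all_order all_algebra ring.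
From mathcomp Require Import all_classical all_reals all_analysis.
From mathcomp Require Import measurable_realfun.

Set Implicit Arguments.
Unset Strict Implicit.
Unset Printing Implicit Defensive.

Import Order.TTheory GRing.Theory Num.Theory.
Import numFieldNormedType.Exports.

Local Open Scope ring_scope.

Section Clifford.
Context {R : comNzRingType} {n : nat}.

(* Cl_{0,n}: an element is its family of coefficients in the basis (e_A). *)
Definition clifford := {ffun {set 'I_n} -> R^o}.
HB.instance Definition _ := GRing.Lmodule.copy clifford {ffun {set 'I_n} -> R^o}.

Implicit Types (A B C : {set 'I_n}) (a b c : clifford) (i j : 'I_n).

Definition symdiff A B : {set 'I_n} := (A :\: B) :|: (B :\: A).

(* e_A * e_B = blade_sign A B *: e_(symdiff A B): reordering contributes one
   sign for each pair i \in A, j \in B with j < i, and e_i * e_i = -1 one sign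
   for each common index. *)
Definition blade_sign A B : R :=
  \prod_(i in A) \prod_(j in B | (j <= i)%N) -1.

Definition blade A : clifford := [ffun B => (B == A)%:R].

Definition clmul a b : clifford :=
  [ffun C => \sum_A blade_sign A (symdiff A C) * a A * b (symdiff A C)].

Lemma in_symdiff A B i : (i \in symdiff A B) = (i \in A) (+) (i \in B).
Proof. by rewrite !inE; case: (i \in A); case: (i \in B). Qed.

Lemma symdiffA A B C : symdiff A (symdiff B C) = symdiff (symdiff A B) C.
Proof. by apply/setP => i; rewrite !in_symdiff addbA. Qed.

Lemma symdiffC A B : symdiff A B = symdiff B A.
Proof. by apply/setP => i; rewrite !in_symdiff addbC. Qed.

Lemma symdiff0 A : symdiff A finset.set0 = A.
Proof. by apply/setP => i; rewrite in_symdiff finset.in_set0 addbF. Qed.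

Lemma symdiff0s A : symdiff finset.set0 A = A.
Proof. by rewrite symdiffC symdiff0. Qed.

Lemma symdiffK A B : symdiff A (symdiff A B) = B.
Proof. by apply/setP => i; rewrite !in_symdiff addKb. Qed.

Lemma symdiffss A : symdiff A A = finset.set0.
Proof. by apply/setP => i; rewrite in_symdiff finset.in_set0 addbb. Qed.

Lemma prod_symdiff (P : pred 'I_n) (g : 'I_n -> R) A B :
  (forall i, g i * g i = 1) ->
  \prod_(i in symdiff A B | P i) g i =
  (\prod_(i in A | P i) g i) * \prod_(i in B | P i) g i.
Proof.
move=> g2; rewrite big_mkcond [X in _ = X * _]big_mkcond.
rewrite [X in _ = _ * X]big_mkcond -big_split; apply: eq_bigr => i _ /=.
rewrite in_symdiff; case: (i \in A); case: (i \in B); case: (P i);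
  by rewrite /= ?mulr1 ?mul1r ?g2.
Qed.

Lemma sq_prodN1 (P : pred 'I_n) :
  (\prod_(i | P i) -1 : R) * (\prod_(i | P i) -1) = 1.
Proof. by rewrite -big_split big1 // => i _; rewrite /= mulrNN mulr1. Qed.

Lemma blade_signDl A B C :
  blade_sign (symdiff A B) C = blade_sign A C * blade_sign B C.
Proof.
rewrite /blade_sign.
have := @prod_symdiff xpredT
  (fun i => \prod_(j in C | (j <= i)%N) -1) A B (fun i => sq_prodN1 _).
by under eq_bigl do rewrite andbT; under [in RHS]eq_bigl do rewrite andbT;
   under [X in _ = _ * X]eq_bigl do rewrite andbT.
Qed.

Lemma blade_signDr A B C :
  blade_sign A (symdiff B C) = blade_sign A B * blade_sign A C.
Proof.
rewrite /blade_sign -big_split; apply: eq_bigr => i _ /=.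
by rewrite prod_symdiff // => j; rewrite mulrNN mulr1.
Qed.

Lemma blade_sign0l A : blade_sign finset.set0 A = 1.
Proof. by rewrite /blade_sign big_set0. Qed.

Lemma blade_sign0r A : blade_sign A finset.set0 = 1.
Proof.
by rewrite /blade_sign big1 // => i _; rewrite big_pred0 // => j; rewrite finset.in_set0.
Qed.

Lemma sq_blade_sign A B : blade_sign A B * blade_sign A B = 1.
Proof. by rewrite -blade_signDr symdiffss blade_sign0r. Qed.

Lemma symdiff_inj A : injective (symdiff A).
Proof. exact: can_inj (symdiffK A). Qed.

Fact clmulA : associative clmul.
Proof.
move=> a b c; apply/ffunP => E; rewrite !ffunE.
transitivity (\sum_A \sum_B blade_sign A (symdiff A E) *
   blade_sign B (symdiff B (symdiff A E)) * a A * b B *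
   c (symdiff B (symdiff A E))).
  apply: eq_bigr => A _; rewrite ffunE mulr_sumr; apply: eq_bigr => B _.
  by rewrite !mulrA; congr (_ * _ * _); rewrite mulrAC.
transitivity (\sum_D \sum_A blade_sign D (symdiff D E) *
   blade_sign A (symdiff A D) * a A * b (symdiff A D) * c (symdiff D E)).
  rewrite [RHS]exchange_big; apply: eq_bigr => A _ /=.
  rewrite [RHS](reindex_inj (@symdiff_inj A)); apply: eq_bigr => B _ /=.
  rewrite symdiffK -!symdiffA.
  have -> : symdiff B (symdiff A E) = symdiff A (symdiff B E).
    by rewrite !symdiffA (symdiffC A B).
  do 3 congr (_ * _).
  set C := symdiff A (symdiff B E).
  have -> : symdiff A E = symdiff B C.
    by rewrite /C (symdiffA A) (symdiffC A B) -symdiffA symdiffK.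
  rewrite blade_signDr blade_signDl /GRing.regular.
  ring.
apply: eq_bigr => D _; rewrite ffunE mulr_sumr mulr_suml; apply: eq_bigr => A _.
by rewrite !mulrA.
Qed.

Fact clmul1l : left_id (blade finset.set0) clmul.
Proof.
move=> a; apply/ffunP => C; rewrite !ffunE (bigD1 finset.set0) //= big1.
  by rewrite addr0 !ffunE eqxx blade_sign0l symdiff0s !mul1r.
by move=> A /negPf A0; rewrite !ffunE A0 mulr0 mul0r.
Qed.

Fact clmul1r : right_id (blade finset.set0) clmul.
Proof.
move=> a; apply/ffunP => C; rewrite !ffunE (bigD1 C) //= big1.
  by rewrite addr0 !ffunE symdiffss eqxx blade_sign0r mul1r mulr1.
move=> A AC; rewrite !ffunE (_ : _ == _ = false) ?mulr0 //.
apply/eqP => AC0; move: AC; rewrite -[C](symdiffK A) AC0 symdiff0.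
by rewrite eqxx.
Qed.

Fact clmulDl : left_distributive clmul +%R.
Proof.
move=> a b c; apply/ffunP => C; rewrite !ffunE -big_split; apply: eq_bigr => A _.
by rewrite !ffunE /= mulrDr mulrDl.
Qed.

Fact clmulDr : right_distributive clmul +%R.
Proof.
move=> a b c; apply/ffunP => C; rewrite !ffunE -big_split; apply: eq_bigr => A _.
by rewrite !ffunE /= mulrDr.
Qed.

Fact cl1_neq0 : blade finset.set0 != 0.
Proof.
by apply/eqP => /ffunP/(_ finset.set0)/eqP; rewrite !ffunE eqxx oner_eq0.
Qed.

HB.instance Definition _ := GRing.Zmodule_isNzRing.Build clifford
  clmulA clmul1l clmul1r clmulDl clmulDr cl1_neq0.

Fact clscalerAl (k : R) a b : k *: (a * b) = (k *: a) * b.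
Proof.
apply/ffunP => C; rewrite !ffunE /= [LHS]mulr_sumr; apply: eq_bigr => A _.
by rewrite !ffunE /GRing.scale /=; ring.
Qed.

HB.instance Definition _ :=
  GRing.Lmodule_isLalgebra.Build R clifford clscalerAl.

Fact clscalerAr (k : R) a b : k *: (a * b) = a * (k *: b).
Proof.
apply/ffunP => C; rewrite !ffunE /= [LHS]mulr_sumr; apply: eq_bigr => A _.
by rewrite !ffunE /GRing.scale /=; ring.
Qed.

HB.instance Definition _ :=
  GRing.Lalgebra_isAlgebra.Build R clifford clscalerAr.

Definition clgen i : clifford := blade [set i]%SET.

(* clconj e_A = (e_A)^-1, and e_A * e_A = blade_sign A A *: 1; see [clconj_gen],
   [clconjM] for the characterization as the anti-automorphism e_i |-> - e_i. *)
Definition clconj a : clifford := [ffun A => blade_sign A A * a A].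

Definition Sc a : R := a finset.set0.

Definition veccoef i a : R := a [set i]%SET.

Definition cldot a b : R := \sum_A a A * b A.

Lemma bladeM A B : blade A * blade B = blade_sign A B *: blade (symdiff A B).
Proof.
apply/ffunP => C; rewrite !ffunE (bigD1 A) //= big1.
  rewrite addr0 !ffunE eqxx mulr1 /GRing.scale /=.
  rewrite (can2_eq (symdiffK A) (symdiffK A)).
  by have [->|_] := eqVneq C (symdiff A B); rewrite ?symdiffK // !mulr0.
by move=> D /negPf DA; rewrite !ffunE DA mulr0 mul0r.
Qed.

Lemma clgen_sq i : clgen i * clgen i = -1.
Proof.
rewrite bladeM symdiffss /blade_sign big_set1.
rewrite (big_pred1 i) ?scaleN1r // => j; rewrite !inE.
by case: eqP => // ->; rewrite leqnn.
Qed.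

Lemma blade_sign11 i j : blade_sign [set i]%SET [set j]%SET = if (j <= i)%N then -1 else 1.
Proof.
rewrite /blade_sign big_set1; case: ifP => ji.
  by rewrite (big_pred1 j) // => k; rewrite !inE; case: eqP => // ->.
by rewrite big_pred0 // => k; rewrite !inE; case: eqP => // ->.
Qed.

Lemma clgen_anticomm i j : clgen i * clgen j + clgen j * clgen i = - (2 * (i == j)%:R).
Proof.
have [->|ij] := eqVneq i j; first by rewrite !clgen_sq mulr1 mulr2n opprD.
rewrite !bladeM (symdiffC [set j]%SET) -scalerDl !blade_sign11 leqNgt.
move: ij; rewrite -val_eqE /= neq_ltn mulr0 oppr0.
rewrite (leq_eqVlt i j).
by case: (ltngtP i j) => //= _ _; rewrite ?addrN ?addNr scale0r.
Qed.

Lemma blade_prod A : blade A = \prod_(i <- enum A) clgen i.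
Proof.
suff key (s : seq 'I_n) : sorted (fun i j => i < j)%N s ->
    \prod_(i <- s) clgen i = blade [set i in s]%SET.
  rewrite key; first by congr blade; apply/setP => i; rewrite !inE mem_enum.
  rewrite /enum_mem -enumT; apply: sorted_filter => [i j k|].
    exact: ltn_trans.
  have : sorted ltn (map val (enum 'I_n)) by rewrite val_enum_ord iota_ltn_sorted.
  by rewrite sorted_map.
elim: s => [_|i s IHs] /=.
  by rewrite big_nil; congr blade; apply/setP => i; rewrite !inE.
rewrite path_sortedE; last by move=> j k l; exact: ltn_trans.
case/andP=> /allP is_ ss; rewrite big_cons IHs // bladeM.
rewrite /blade_sign big_set1 big1_seq ?scale1r; last first.
  move=> j /andP[/andP[]]; rewrite inE => /is_.
  by rewrite ltnNge => /negbTE ->.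
congr blade; apply/setP => j; rewrite in_symdiff !inE.
case: eqVneq => //= ->; have [/is_|//] := boolP (i \in s).
by rewrite ltnn.
Qed.

Lemma clconj1 : clconj 1 = 1.
Proof.
apply/ffunP => A; rewrite !ffunE.
by case: eqP => [->|_]; rewrite ?blade_sign0l ?mulr1 ?mulr0.
Qed.

Lemma clconj_gen i : clconj (clgen i) = - clgen i.
Proof.
apply/ffunP => A; rewrite !ffunE; case: eqP => [->|_]; last by rewrite mulr0 oppr0.
by rewrite blade_sign11 leqnn mulr1.
Qed.

Lemma clconj_linear (k : R) a b : clconj (k *: a + b) = k *: clconj a + clconj b.
Proof.
by apply/ffunP => A; rewrite !ffunE mulrDr /GRing.scale /= mulrCA.
Qed.

Lemma clconjM a b : clconj (a * b) = clconj b * clconj a.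
Proof.
apply/ffunP => C; rewrite !ffunE mulr_sumr [RHS](reindex_inj (@symdiff_inj C)) /=.
apply: eq_bigr => A _; rewrite !ffunE /=.
have -> : symdiff (symdiff C A) C = A by rewrite (symdiffC _ C) symdiffK.
rewrite (symdiffC C A).
have [B BE] : exists B, B = symdiff A C by exists (symdiff A C).
rewrite -BE; have -> : C = symdiff A B by rewrite BE symdiffK.
rewrite !blade_signDl !blade_signDr.
transitivity ((blade_sign A B * blade_sign A B) * (blade_sign A A *
  blade_sign B A * blade_sign B B) * (a A * b B)).
  ring.
rewrite sq_blade_sign mul1r.
ring.
Qed.

Lemma Sc_clconjM a b : Sc (clconj a * b) = cldot a b.
Proof.
rewrite /Sc ffunE; apply: eq_bigr => A _.
by rewrite symdiff0 ffunE !mulrA sq_blade_sign mul1r.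
Qed.

Lemma Sc_Mclconj a b : Sc (a * clconj b) = cldot a b.
Proof.
rewrite /Sc ffunE; apply: eq_bigr => A _.
rewrite symdiff0 ffunE -mulrA (mulrCA (a A)) !mulrA.
by rewrite sq_blade_sign mul1r.
Qed.

End Clifford.
Arguments clifford : clear implicits.

Definition clnorm {R : realType} {n} (a : clifford R n) : R :=
  Num.sqrt (cldot a a).

Local Open Scope classical_set_scope.

Section BorelRn.
Context {R : realType} {n : nat}.

Definition Rn_display : measure_display. Proof. exact. Qed.

Let borel0 : <<s @open 'rV[R]_n >> set0.
Proof. exact: sigma_algebra0. Qed.
Let borelC A : <<s @open 'rV[R]_n >> A -> <<s @open 'rV[R]_n >> (~` A).
Proof. exact: sigma_algebraC. Qed.
Let borelU (F : (set 'rV[R]_n)^nat) : (forall i, <<s @open 'rV[R]_n >> (F i)) ->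
  <<s @open 'rV[R]_n >> (\bigcup_i F i).
Proof. exact: sigma_algebra_bigcup. Qed.

HB.instance Definition _ :=
  @isMeasurable.Build Rn_display 'rV[R]_n <<s open >> borel0 borelC borelU.

Lemma open_measurable_Rn (U : set 'rV[R]_n) : open U -> measurable U.
Proof. exact: sub_sigma_algebra. Qed.

Let cube (p : 'rV[rat]_n * nat) : set 'rV[R]_n :=
  [set x | forall i, `|x 0 i - ratr (p.1 0 i)| < p.2.+1%:R^-1].

Let open_bigcup_cubes (U : set 'rV[R]_n) : open U ->
  U = \bigcup_(p in [set p | cube p `<=` U]) cube p.
Proof.
move=> oU; apply/seteqP; split => [x Ux|x [p pU /pU//]].
have /nbhs_ballP[e /= e0 eU] : nbhs x U by exact: open_nbhs_nbhs.
have [k ke] : exists k, k.+1%:R^-1 < e / 2 :> R.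
  have [k _ /(_ k (leqnn k))] := near_infty_natSinv_lt (PosNum (divr_gt0 e0 (ltr0n _ 2))).
  by exists k.
have k0 : 0 < k.+1%:R^-1 :> R by rewrite invr_gt0.
have /choice[q qx] : forall i, exists q : rat, `|x 0 i - ratr q| < k.+1%:R^-1.
  move=> i; have /rat_in_itvoo[q] : x 0 i - k.+1%:R^-1 < x 0 i + k.+1%:R^-1.
    by rewrite ltrD2l (lt_trans _ k0)// oppr_lt0.
  by rewrite in_itv/= => /andP[? ?]; exists q; rewrite distrC ltr_distl; apply/andP.
exists (\row_i q i, k); last by move=> i /=; rewrite mxE.
move=> y /= cy; apply: eU; split => // i j; rewrite ord1 /ball /=.
have := qx j; have := cy j; rewrite mxE distrC => yq xq.
rewrite -(subrKA (ratr (q j))) (le_lt_trans (ler_normD _ _))//.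
by rewrite (lt_trans (ltrD xq yq))// [e]splitr ltrD.
Qed.

Lemma measurable_fun_row d (T : measurableType d) (f : T -> 'rV[R]_n) :
  (forall i, measurable_fun setT (fun t => f t 0 i)) -> measurable_fun setT f.
Proof.
move=> mf; apply: (@measurability _ _ _ _ _ _ (@open 'rV[R]_n)) => //.
move=> _ [U oU <-]; rewrite setTI (open_bigcup_cubes oU) preimage_bigcup.
rewrite bigcup_mkcond; apply: countable_bigcupT_measurable => // p.
case: ifPn => // _.
rewrite (_ : _ @^-1` _ = \bigcap_i
    ((fun t => f t 0 i) @^-1` ball (ratr (p.1 0 i) : R) p.2.+1%:R^-1)).
  apply: fin_bigcap_measurable => // i _; rewrite -[X in measurable X]setTI.
  by apply: mf => //; exact: measurable_ball.
apply/seteqP; split => t /= ct i; first by move=> _; rewrite /ball/= distrC.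
by rewrite distrC; exact: ct.
Qed.

End BorelRn.

Section LebesgueRn.
Context {R : realType}.
Local Notation mR := (measurableTypeR R).

Section step.
Context {n : nat}.
Variable m : {sigma_finite_measure set (n.-tuple mR) -> \bar R}.

Definition tuple_cons (p : mR * n.-tuple mR) : n.+1.-tuple mR :=
  [tuple of p.1 :: p.2].

Let measurable_tuple_cons : measurable_fun setT tuple_cons.
Proof. exact: measurable_cons. Qed.

Definition lebesgue_tupleS := pushforward (lebesgue_measure \x m)%E tuple_cons.

HB.instance Definition _ := Measure.copy lebesgue_tupleS
  (measure_function_pushforward__canonical__measure_function_Measure
     (lebesgue_measure \x m)%E measurable_tuple_cons).

Let sigma_finite_lebesgue_tupleS : sigma_finite setT lebesgue_tupleS.
Proof.
have /sigma_finiteP[F [TF ndF Ff]] := sigma_finiteT (@lebesgue_measure R).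
have /sigma_finiteP[G [TG ndG Gf]] := sigma_finiteT m.
exists (fun k => [set t : n.+1.-tuple mR | F k (thead t) /\ G k [tuple of behead t]]).
  apply/seteqP; split => // t _.
  have : setT (thead t) by []. rewrite TF => -[k _ Fk].
  have : setT [tuple of behead t] by []. rewrite TG => -[l _ Gl].
  exists (maxn k l) => //; split.
    by move: (thead t) Fk; exact/subsetPset/ndF/leq_maxl.
  by move: [tuple of behead t] Gl; exact/subsetPset/ndG/leq_maxr.
move=> k; have [mF Foo] := Ff k; have [mG Goo] := Gf k; split.
  apply: measurableI; rewrite -[X in measurable X]setTI.
    by apply: (@measurable_tnth _ mR n.+1 ord0) => //.
  exact: (@measurable_behead _ mR n).
rewrite /lebesgue_tupleS /pushforward (_ : _ @^-1` _ = F k `*` G k).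
  by rewrite product_measure1E// lte_mul_pinfty// ge0_fin_numE.
by apply/seteqP; split => -[x t] /=; rewrite theadE;
  rewrite (_ : [tuple of behead (tuple_cons (x, t))] = t)//; exact/val_inj.
Qed.

HB.instance Definition _ := Measure_isSigmaFinite.Build _ _ _ lebesgue_tupleS
  sigma_finite_lebesgue_tupleS.

End step.

Fixpoint lebesgue_tuple n : {sigma_finite_measure set (n.-tuple mR) -> \bar R} :=
  match n with
  | 0 => \d_[tuple]
  | k.+1 => lebesgue_tupleS (lebesgue_tuple k)
  end.

Definition row_of_tuple n (t : n.-tuple mR) : 'rV[R]_n := \row_i tnth t i.

Lemma measurable_row_of_tuple n : measurable_fun setT (@row_of_tuple n).
Proof.
apply: measurable_fun_row => i; rewrite (_ : (fun _ => _) = @tnth _ mR ^~ i).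
  exact: measurable_tnth.
by apply/funext => t; rewrite mxE.
Qed.

Definition lebesgue_Rn {n} : set 'rV[R]_n -> \bar R :=
  pushforward (lebesgue_tuple n) (@row_of_tuple n).

HB.instance Definition _ n := Measure.copy (@lebesgue_Rn n)
  (measure_function_pushforward__canonical__measure_function_Measure
     (lebesgue_tuple n) (@measurable_row_of_tuple n)).

Lemma lebesgue_tuple_box n (A : 'I_n -> set mR) :
  (forall i, measurable (A i)) ->
  lebesgue_tuple n [set t | forall i, A i (tnth t i)] =
  (\prod_i lebesgue_measure (A i))%E.
Proof.
elim: n A => [|n IHn] A mA /=.
  by rewrite big_ord0 diracE mem_set// => -[].
rewrite big_ord_recl -IHn// /lebesgue_tupleS /pushforward.
rewrite -product_measure1E//; last first.
  rewrite (_ : [set _ | _] = \bigcap_i (@tnth n mR ^~ i @^-1` A (lift ord0 i))).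
    apply: fin_bigcap_measurable => // i _; rewrite -[X in measurable X]setTI.
    exact: measurable_tnth.
  by apply/seteqP; split => t /= At i; [move=> _|]; exact: At.
congr (_ _); apply/seteqP; split => -[x t] /= => [At|[Ax At] i].
  split => [|i]; first exact: At ord0.
  by have := At (lift ord0 i); rewrite tnthS.
by case: (unliftP ord0 i) => [j ->|->]; rewrite ?tnthS.
Qed.

Lemma lebesgue_Rn_box n (A : 'I_n -> set mR) :
  (forall i, measurable (A i)) ->
  lebesgue_Rn [set x : 'rV[R]_n | forall i, A i (x 0 i)] =
  (\prod_i lebesgue_measure (A i))%E.
Proof.
move=> mA; rewrite -lebesgue_tuple_box//; congr (lebesgue_tuple _ _).
by apply/seteqP; split => t /= At i; have := At i; rewrite mxE.
Qed.

End LebesgueRn.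

Section Calculus.
Context {R : realType} {n : nat}.
Implicit Types (x : 'rV[R]_n) (f : 'rV[R]_n -> R) (U : set 'rV[R]_n).
Implicit Types (a b w : 'rV[R]_n -> clifford R n) (i : 'I_n).

Definition partial i f : 'rV[R]_n -> R := 'D_(delta_mx 0 i) (f : _ -> R^o).

Definition has_partials f x :=
  forall i, derivable (f : _ -> R^o) x (delta_mx 0 i).

Definition has_second_partials f x :=
  (\forall y \near x, has_partials f y) /\
  forall i, has_partials (partial i f) x.

Definition laplacian f x := \sum_i partial i (partial i f) x.

Definition cl_has_partials w x :=
  forall A, has_partials (fun y => w y A) x.

Definition clpartial i w x : clifford R n :=
  [ffun A => partial i (fun y => w y A) x].

Definition dirac w x : clifford R n := \sum_i clgen i * clpartial i w x.

(* div (Vec a) *)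
Definition divVec a x := \sum_i partial i (fun y => veccoef i (a y)) x.

(* (D - a C - b) w *)
Definition DCl a b w x : clifford R n :=
  dirac w x - a x * clconj (w x) - b x * w x.

(* (D - M^a C - b) w *)
Definition DCr a b w x : clifford R n :=
  dirac w x - clconj (w x) * a x - b x * w x.

Definition C1_on U f :=
  forall x, U x ->
    [/\ has_partials f x, {for x, continuous f} &
        forall i, {for x, continuous (partial i f)}].

Definition bounded_domain U := [/\ open U, connected U, U !=set0 & bounded_set U].

(* Near each boundary point, U is the negative side of a C^1 function with
   nonvanishing gradient. Any C^k boundary, k >= 1, is of this kind. *)
Definition C1_boundary U :=
  forall p, (closure U `\` U°) p ->
  exists (V : set 'rV[R]_n) (psi : 'rV[R]_n -> R),
    [/\ open V, V p, C1_on V psi, (exists i, partial i psi p != 0) &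
        forall x, V x -> (U x <-> psi x < 0)].

Definition Linfty U a :=
  (forall A, measurable_fun U (fun x => a x A : R)) /\
  exists M : R, {ae lebesgue_Rn, forall x, U x -> clnorm (a x) <= M}.

Definition smooth f :=
  forall (s : seq 'I_n) x,
    has_partials (foldr partial f s) x /\ {for x, continuous (foldr partial f s)}.

Definition test_function U f :=
  [/\ smooth f, compact (closure [set x | f x != 0]) &
      closure [set x | f x != 0] `<=` U].

(* A distribution on U is given by its values on test functions phi, a locally
   integrable f being the distribution [wfun U f]. For f locally bounded,
   [wpartial U i f] extends to C^1 functions psi with compact support in U, so
   that the product of a C^1 function h with d_i f is
   phi |-> [wpartial U i f (h * phi)]. *)

Implicit Types (phi psi : 'rV[R]_n -> R).

Definition wpartial U i f psi : R :=
  - \int[lebesgue_Rn]_(x in U) (f x * partial i psi x).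

(* f is C^1: this is the distributional divergence of its classical gradient. *)
Definition wlaplacian U f phi : R := \sum_i wpartial U i (partial i f) phi.

Definition wdivVec U a psi : R :=
  \sum_i wpartial U i (fun x => veccoef i (a x)) psi.

Definition wfun U f phi : R := \int[lebesgue_Rn]_(x in U) (f x * phi x).

Definition clwfun U w phi : clifford R n :=
  [ffun A => wfun U (fun x => w x A) phi].

Definition clwpartial U i w phi : clifford R n :=
  [ffun A => wpartial U i (fun x => w x A) phi].

Definition wdirac U w phi : clifford R n :=
  \sum_i clgen i * clwpartial U i w phi.

Definition wDCl U a b w phi : clifford R n :=
  wdirac U w phi - clwfun U (fun x => a x * clconj (w x)) phi
  - clwfun U (fun x => b x * w x) phi.

Definition wDCr U a b w phi : clifford R n :=
  wdirac U w phi - clwfun U (fun x => clconj (w x) * a x) phi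
  - clwfun U (fun x => b x * w x) phi.

End Calculus.

(* Main.v *)
Require Import Defs.
From mathcomp Require Import all_boot all_order all_algebra ring.
From mathcomp Require Import all_classical all_reals all_analysis.
From mathcomp Require Import measurable_realfun.

Import Order.TTheory GRing.Theory Num.Theory.
Import numFieldNormedType.Exports.

Local Open Scope classical_set_scope.
Local Open Scope ring_scope.

(** Put w = (D - M^alpha C - conj beta) h0. Since h0 is scalar, w is the gradient
    of h0 minus h0 eta with eta = alpha + conj beta, and for every w the scalar
    part of (D - alpha C - beta) w is - div Vec w - eta . w, because
    Sc (a conj w) = a . w and Sc (b w) = conj b . w. Expanding, the terms
    eta . grad h0 from the divergence and from the scalar product cancel and
    leave - Delta h0 + (|eta|^2 + div Vec eta) h0. The second identity is the
    same one with conj beta in place of beta, since Sc (conj w a) = a . w too.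

    For merely bounded alpha and beta this computation takes place under the
    integral sign, against the test function phi. Every function of h0 occurring
    there is multiplied by phi or one of its partials, hence is bounded even
    though h0 may be unbounded near the boundary, and no integration by parts
    is needed. *)

(** * Scalar part, conjugation and scalar product in the Clifford algebra *)

Section CliffordAlgebra.
Context {R : comNzRingType} {n : nat}.
Implicit Types (a b c : clifford R n) (k : R).

Lemma ScD a b : Sc (a + b) = Sc a + Sc b.
Proof. by rewrite /Sc ffunE. Qed.

Lemma ScN a : Sc (- a) = - Sc a.
Proof. by rewrite /Sc ffunE. Qed.

Lemma Sc_sum (F : 'I_n -> clifford R n) : Sc (\sum_i F i) = \sum_i Sc (F i).
Proof. by rewrite /Sc sum_ffunE. Qed.

Lemma clconjK : involutive (@clconj R n).
Proof. by move=> a; apply/ffunP => A; rewrite !ffunE mulrA sq_blade_sign mul1r. Qed.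

Lemma clconj_scalar k : clconj k%:A = k%:A :> clifford R n.
Proof.
have := clconj_linear k (1 : clifford R n) 0.
have -> : clconj 0 = 0 :> clifford R n by apply/ffunP => A; rewrite !ffunE mulr0.
by rewrite !addr0 clconj1.
Qed.

Lemma cldotC a b : cldot a b = cldot b a.
Proof. by apply: eq_bigr => A _; rewrite mulrC. Qed.

Lemma cldotDl a b c : cldot (a + b) c = cldot a c + cldot b c.
Proof. by rewrite -big_split; apply: eq_bigr => A _; rewrite ffunE mulrDl. Qed.

Lemma cldotDr a b c : cldot c (a + b) = cldot c a + cldot c b.
Proof. by rewrite cldotC cldotDl !(cldotC c). Qed.

Lemma cldotZr k a c : cldot c (k *: a) = k * cldot c a.
Proof. by rewrite mulr_sumr; apply: eq_bigr => A _; rewrite ffunE mulrCA. Qed.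

Lemma cldotNr a c : cldot c (- a) = - cldot c a.
Proof. by rewrite -scaleN1r cldotZr mulN1r. Qed.

Lemma cldot_conj a b : cldot (clconj a) (clconj b) = cldot a b.
Proof.
by apply: eq_bigr => A _; rewrite !ffunE mulrACA sq_blade_sign mul1r.
Qed.

Lemma cldot_sumr a (F : 'I_n -> clifford R n) :
  cldot a (\sum_i F i) = \sum_i cldot a (F i).
Proof.
rewrite /cldot exchange_big /=; apply: eq_bigr => A _.
by rewrite sum_ffunE mulr_sumr.
Qed.

Lemma cldot_gen i a : cldot a (clgen i) = veccoef i a.
Proof.
rewrite /cldot (bigD1 [set i]%SET) //= !ffunE eqxx mulr1 big1 ?addr0 // => A.
by rewrite !ffunE => /negPf ->; rewrite mulr0.
Qed.

(** Since [clgen i] is the negative of its conjugate, this is the scalar product with [clgen i] up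
    to sign. It turns the scalar part of a Dirac derivative into minus a divergence. *)
Lemma Sc_genM i a : Sc (clgen i * a) = - veccoef i a.
Proof.
by rewrite -cldot_gen cldotC -Sc_clconjM clconj_gen mulNr ScN opprK.
Qed.

Lemma veccoef_gen i j : veccoef i (clgen j : clifford R n) = (i == j)%:R.
Proof. by rewrite /veccoef ffunE (inj_eq set1_inj). Qed.

Lemma veccoef_conj i a : veccoef i (clconj a) = - veccoef i a.
Proof. by rewrite /veccoef ffunE blade_sign11 leqnn mulN1r. Qed.

End CliffordAlgebra.

Lemma sqr_clnorm (R : realType) n (a : clifford R n) : clnorm a ^+ 2 = cldot a a.
Proof. by rewrite sqr_sqrtr //; apply: sumr_ge0 => A _; exact: sqr_ge0. Qed.

(** * Pointwise calculus and the classical identities *)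

Section Gradient.
Context {R : realType} {n : nat}.
Implicit Types (x y : 'rV[R]_n) (f g : 'rV[R]_n -> R) (i : 'I_n).
Implicit Types (eta : 'rV[R]_n -> clifford R n).

Lemma partialM i f g x : has_partials f x -> has_partials g x ->
  partial i (fun y => f y * g y) x = partial i f x * g x + f x * partial i g x.
Proof.
move=> df dg; rewrite /partial (@deriveM _ _ f g) //.
by rewrite /GRing.scale /= addrC mulrC.
Qed.

Lemma has_partialsM f g x : has_partials f x -> has_partials g x ->
  has_partials (fun y => f y * g y) x.
Proof. by move=> df dg i; apply: (@derivableM _ _ f g). Qed.

Lemma partialB i f g x : has_partials f x -> has_partials g x ->
  partial i (fun y => f y - g y) x = partial i f x - partial i g x.
Proof. by move=> df dg; rewrite /partial (@deriveB _ _ _ f g). Qed.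

Lemma partialD i f g x : has_partials f x -> has_partials g x ->
  partial i (fun y => f y + g y) x = partial i f x + partial i g x.
Proof. by move=> df dg; rewrite /partial (@deriveD _ _ _ f g). Qed.

Lemma partialN i f x : has_partials f x ->
  partial i (fun y => - f y) x = - partial i f x.
Proof. by move=> df; rewrite /partial (@deriveN _ _ _ f). Qed.

Lemma has_partialsD f g x : has_partials f x -> has_partials g x ->
  has_partials (fun y => f y + g y) x.
Proof. by move=> df dg i; apply: (@derivableD _ _ _ f g). Qed.

Definition clgrad f x : clifford R n := \sum_i partial i f x *: clgen i.

Lemma dirac_scalar f x : Defs.dirac (fun y => (f y)%:A : clifford R n) x = clgrad f x.
Proof.
rewrite /Defs.dirac; apply: eq_bigr => i _; rewrite -[RHS]mulr1 -scalerAl scalerAr.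
congr (_ * _); apply/ffunP => A; rewrite !ffunE /=.
have [->|A0] := eqVneq A finset.set0.
  rewrite /GRing.scale/= mulr1; congr (partial i _ x); apply/funext => y.
  by rewrite !ffunE eqxx /GRing.scale/= mulr1.
(* Off the empty index set, the coefficients of a scalar function vanish identically, and so do
   their partials. *)
rewrite (_ : (fun _ => _) = cst 0) ?[LHS]derive_cst ?scaler0//.
by apply/funext => y; rewrite !ffunE (negPf A0) scaler0.
Qed.

Lemma veccoef_grad i f x : veccoef i (clgrad f x) = partial i f x.
Proof.
rewrite /veccoef /clgrad sum_ffunE (bigD1 i) //= big1 => [|j ji];
  rewrite ffunE -/(veccoef _ _) veccoef_gen ?eqxx.
  by rewrite /GRing.scale /= mulr1 addr0.
by rewrite eq_sym (negPf ji) scaler0.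
Qed.

Lemma cldot_grad eta f x :
  cldot (eta x) (clgrad f x) = \sum_i veccoef i (eta x) * partial i f x.
Proof.
rewrite cldot_sumr; apply: eq_bigr => i _.
by rewrite cldotZr cldot_gen mulrC.
Qed.

(** The common form of both inner operators on a scalar function: scalars are central and fixed by
    conjugation, so multiplying by alpha on the left or on the right makes no difference. *)
Definition twisted_grad eta f x : clifford R n := clgrad f x - f x *: eta x.

Lemma veccoef_twisted_grad i eta f x :
  veccoef i (twisted_grad eta f x) = partial i f x - f x * veccoef i (eta x).
Proof. by rewrite -veccoef_grad /veccoef !ffunE. Qed.

Lemma DCl_scalar (a b : 'rV[R]_n -> clifford R n) f :
  DCl a b (fun y => (f y)%:A : clifford R n) = twisted_grad (fun x => a x + b x) f.
Proof.
apply/funext => x; rewrite /DCl dirac_scalar clconj_scalar -!scalerAr !mulr1.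
by rewrite /twisted_grad scalerDr opprD addrA.
Qed.

Lemma DCr_scalar (a b : 'rV[R]_n -> clifford R n) f :
  DCr a b (fun y => (f y)%:A : clifford R n) = twisted_grad (fun x => a x + b x) f.
Proof.
apply/funext => x; rewrite /DCr dirac_scalar clconj_scalar -scalerAr -scalerAl.
by rewrite mulr1 mul1r /twisted_grad scalerDr opprD addrA.
Qed.

Lemma Sc_dirac (w : 'rV[R]_n -> clifford R n) x : Sc (Defs.dirac w x) = - divVec w x.
Proof.
rewrite Sc_sum -sumrN; apply: eq_bigr => i _.
by rewrite Sc_genM /veccoef ffunE.
Qed.

Lemma Sc_DCl (a b w : 'rV[R]_n -> clifford R n) x :
  Sc (DCl a b w x) = - divVec w x - cldot (a x + clconj (b x)) (w x).
Proof.
rewrite /DCl !ScD !ScN Sc_dirac Sc_Mclconj cldotDl opprD addrA.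
by rewrite -[b x in LHS]clconjK Sc_clconjM.
Qed.

(** The scalar product is symmetric, so after taking [Sc] the side on which [a] multiplies is
    invisible and the value is that for [DCl]. *)
Lemma Sc_DCr (a b w : 'rV[R]_n -> clifford R n) x :
  Sc (DCr a b w x) = - divVec w x - cldot (a x + clconj (b x)) (w x).
Proof.
rewrite /DCr !ScD !ScN Sc_dirac Sc_clconjM cldotDl opprD addrA (cldotC (w x)).
by rewrite -[b x in LHS]clconjK Sc_clconjM.
Qed.

Lemma cldot_twisted_grad eta f x : cldot (eta x) (twisted_grad eta f x) =
  \sum_i veccoef i (eta x) * partial i f x - f x * cldot (eta x) (eta x).
Proof. by rewrite /twisted_grad cldotDr cldotNr cldotZr cldot_grad. Qed.

(** Product rule for each component of [f *: eta]. *)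
Lemma divVec_twisted_grad eta f x : has_second_partials f x ->
  cl_has_partials eta x ->
  divVec (twisted_grad eta f) x
  = laplacian f x - \sum_i veccoef i (eta x) * partial i f x
    - f x * divVec eta x.
Proof.
move=> [/nbhs_singleton df d2f] deta.
rewrite /divVec /laplacian mulr_sumr -!sumrB; apply: eq_bigr => i _.
rewrite (funext (fun y => veccoef_twisted_grad i eta f y)).
have deta_i : has_partials (fun y => veccoef i (eta y)) x by exact: deta.
rewrite partialB; [|exact: d2f|exact: has_partialsM].
by rewrite partialM //; ring.
Qed.

Lemma divVecD (a b : 'rV[R]_n -> clifford R n) x :
  cl_has_partials a x -> cl_has_partials b x ->
  divVec (fun y => a y + b y) x = divVec a x + divVec b x.
Proof.
move=> da db; rewrite -big_split; apply: eq_bigr => i _ /=.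
rewrite /veccoef -partialD//; congr (partial i _ x).
by apply/funext => y; rewrite ffunE.
Qed.

Lemma divVec_conj (b : 'rV[R]_n -> clifford R n) x : cl_has_partials b x ->
  divVec (fun y => clconj (b y)) x = - divVec b x.
Proof.
move=> db; rewrite -sumrN; apply: eq_bigr => i _ /=.
by rewrite (funext (fun y => veccoef_conj i (b y))) partialN //; exact: db.
Qed.

Lemma cl_has_partialsD (a b : 'rV[R]_n -> clifford R n) x :
  cl_has_partials a x -> cl_has_partials b x ->
  cl_has_partials (fun y => a y + b y) x.
Proof.
move=> da db A; have -> : (fun y => (a y + b y) A) = (fun y => a y A + b y A).
  by apply/funext => y; rewrite ffunE.
exact: has_partialsD.
Qed.

Lemma cl_has_partials_conj (b : 'rV[R]_n -> clifford R n) x :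
  cl_has_partials b x -> cl_has_partials (fun y => clconj (b y)) x.
Proof.
move=> db A.
have -> : (fun y => clconj (b y) A) = (fun y => blade_sign A A * b y A).
  by apply/funext => y; rewrite ffunE.
by apply: has_partialsM => // i; exact: derivable_cst.
Qed.

(** Stated for arbitrary [eta], so that one computation serves both orders of composition: the
    first-order terms in [f] cancel. *)
Lemma twisted_laplacian eta f x : has_second_partials f x ->
  cl_has_partials eta x ->
  - divVec (twisted_grad eta f) x - cldot (eta x) (twisted_grad eta f x)
  = - laplacian f x + (cldot (eta x) (eta x) + divVec eta x) * f x.
Proof.
by move=> d2f deta; rewrite divVec_twisted_grad// cldot_twisted_grad; ring.
Qed.

(** Conjugation reverses vector parts, whence the minus sign before the divergence of [b]. *)
Lemma Sc_DCl_twisted_grad (a b : 'rV[R]_n -> clifford R n) f x :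
  has_second_partials f x -> cl_has_partials a x -> cl_has_partials b x ->
  let eta y := a y + clconj (b y) in
  Sc (DCl a b (twisted_grad eta f) x)
  = - laplacian f x + (cldot (eta x) (eta x) + divVec a x - divVec b x) * f x.
Proof.
move=> d2f da db eta; have dbc := cl_has_partials_conj _ _ db.
rewrite Sc_DCl twisted_laplacian //; last exact: cl_has_partialsD.
by rewrite divVecD // divVec_conj // addrA.
Qed.

Lemma Sc_DCr_twisted_grad (a b : 'rV[R]_n -> clifford R n) f x :
  has_second_partials f x -> cl_has_partials a x -> cl_has_partials b x ->
  let eta y := a y + clconj (b y) in
  Sc (DCr a b (twisted_grad eta f) x)
  = - laplacian f x + (cldot (eta x) (eta x) + divVec a x - divVec b x) * f x.
Proof.
by move=> d2f da db eta; rewrite -Sc_DCl_twisted_grad // Sc_DCl Sc_DCr.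
Qed.

End Gradient.

Lemma cldotDD (R : realType) n (a b : clifford R n) :
  cldot (a + b) (a + b) = clnorm a ^+ 2 + clnorm b ^+ 2 + 2 * cldot a b.
Proof. by rewrite !sqr_clnorm !cldotDl !cldotDr (cldotC b a); ring. Qed.

Lemma clnorm_conj (R : realType) n (a : clifford R n) : clnorm (clconj a) = clnorm a.
Proof. by rewrite /clnorm cldot_conj. Qed.

(** * Essentially bounded functions and their integrals *)

Section EssBounded.
Context {d : measure_display} {T : measurableType d} {R : realType}.
Context (mu : {measure set T -> \bar R}) (D : set T).
Implicit Types (f g : T -> R).

(** This class is closed under sums and products and, on a set of finite measure, consists of
    integrable functions. Integrability of each integrand is thus read off its algebraic form. *)
Definition ess_bounded f := measurable_fun D f /\
  exists M : R, {ae mu, forall x, D x -> `|f x| <= M}.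

Lemma ess_bounded_cst k : ess_bounded (fun=> k).
Proof. by split => //; exists `|k|; apply: aeW. Qed.

Lemma ess_boundedD f g : ess_bounded f -> ess_bounded g ->
  ess_bounded (fun x => f x + g x).
Proof.
move=> [mf [M fM]] [mg [N gN]]; split; first exact: measurable_funD.
exists (M + N); apply: filterS2 fM gN => x fM gN Dx.
by rewrite (le_trans (ler_normD _ _)) // lerD ?fM ?gN.
Qed.

Lemma ess_boundedM f g : ess_bounded f -> ess_bounded g ->
  ess_bounded (fun x => f x * g x).
Proof.
move=> [mf [M fM]] [mg [N gN]]; split; first exact: measurable_funM.
exists (M * N); apply: filterS2 fM gN => x fM gN Dx.
by rewrite normrM ler_pM ?fM ?gN.
Qed.

Lemma ess_boundedN f : ess_bounded f -> ess_bounded (fun x => - f x).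
Proof.
move=> bf; rewrite (_ : (fun _ => _) = (fun x => -1 * f x)).
  by apply: ess_boundedM => //; exact: ess_bounded_cst.
by apply/funext => x; rewrite mulN1r.
Qed.

Lemma ess_boundedB f g : ess_bounded f -> ess_bounded g ->
  ess_bounded (fun x => f x - g x).
Proof. by move=> bf bg; apply: ess_boundedD => //; exact: ess_boundedN. Qed.

Lemma ess_bounded_sum (I : Type) (s : seq I) (F : I -> T -> R) :
  (forall i, ess_bounded (F i)) -> ess_bounded (fun x => \sum_(i <- s) F i x).
Proof.
move=> bF; elim: s => [|i s IHs].
  under [X in ess_bounded X]eq_fun do rewrite big_nil.
  exact: ess_bounded_cst.
under [X in ess_bounded X]eq_fun do rewrite big_cons.
exact: ess_boundedD.
Qed.

(** Allows the product rule to be used for functions that are differentiable on the domain only. *)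
Lemma eq_ess_bounded f g : {in D, f =1 g} -> ess_bounded f -> ess_bounded g.
Proof.
move=> fg [mf [M fM]]; split; first exact: eq_measurable_fun mf.
exists M; apply: filterS fM => x fM Dx.
by rewrite -fg ?inE //; exact: fM.
Qed.

Hypotheses (mD : measurable D) (finD : (mu D < +oo)%E).

Lemma ess_bounded_integrable f : ess_bounded f -> mu.-integrable D (EFin \o f).
Proof.
move=> [mf [M fM]]; apply/integrableP; split; first exact/measurable_EFinP.
(* The absolute value matters: on a null set the essential bound [M] may be negative. *)
apply: (@le_lt_trans _ _ (`|M|%:E * mu D)%E); last by rewrite lte_mul_pinfty.
apply: integral_le_bound => //; first exact/measurable_EFinP.
by apply: filterS fM => x fM /fM; rewrite lee_fin => /le_trans; apply; exact: ler_norm.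
Qed.

Lemma Rintegral_sum (I : Type) (s : seq I) (F : I -> T -> R) :
  (forall i, mu.-integrable D (EFin \o F i)) ->
  \int[mu]_(x in D) (\sum_(i <- s) F i x) = \sum_(i <- s) \int[mu]_(x in D) F i x.
Proof.
move=> iF; elim: s => [|i s IHs].
  under eq_Rintegral do rewrite big_nil.
  by rewrite Rintegral_cst // mul0r big_nil.
under eq_Rintegral do rewrite big_cons.
rewrite RintegralD // ?big_cons ?IHs //.
rewrite (_ : _ \o _ = (fun x => \sum_(j <- s) (F j x)%:E)%E).
  by apply: (integrable_sum mD) => j _; exact: iF.
by apply/funext => x; rewrite /= sumEFin.
Qed.

End EssBounded.

(** * Finite measure of bounded open sets and bounds from compact support *)

Section BoundedSets.
Context {R : realType} {n : nat}.
Implicit Types (U K : set 'rV[R]_n) (f : 'rV[R]_n -> R).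

Lemma continuous_measurable_Rn U f : open U ->
  (forall x, U x -> {for x, continuous f}) -> measurable_fun U f.
Proof.
move=> oU cf; apply: (measurability _ (RGenOpens.measurableE R)).
move=> _ [_ [a [b ->] <-]]; apply: open_measurable_Rn.
rewrite openE => x [Ux fx]; apply: filterI; first exact: open_nbhs_nbhs.
by apply: cf => //; apply: open_nbhs_nbhs; split => //; exact: interval_open.
Qed.

Lemma lebesgue_Rn_bounded U : open U -> bounded_set U -> (lebesgue_Rn U < +oo)%E.
Proof.
(* Boundedness supplies a bound for every real strictly above [M], hence the added 1; [U] then lies
   in the cube of half-side [N]. *)
move=> oU [M [_ UM]]; pose N := M + 1.
pose I : set (measurableTypeR R) := `[- N, N]%classic.
pose box := [set x : 'rV[R]_n | forall i, I (x 0 i)].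
have UN : U `<=` box.
  move=> x Ux i; rewrite /I /= in_itv /= -ler_norml.
  have /le_trans : `|x 0 i| <= `|x|.
    rewrite [leRHS]/Num.norm /= mx_normrE; apply/bigmax_geP; right => /=.
    by exists (0, i).
  by apply; apply: UM Ux; rewrite /N ltrDl.
have mI (i : 'I_n) : measurable I by exact: measurable_itv.
apply: (@le_lt_trans _ _ (lebesgue_Rn box)).
  apply: le_measure; rewrite ?inE //; first exact: open_measurable_Rn.
  (* The cube is measurable as a finite intersection of preimages under the continuous
     coordinates. *)
  rewrite (_ : box = \bigcap_i ((fun x : 'rV[R]_n => x 0 i) @^-1` I)).
    apply: fin_bigcap_measurable => // i _; rewrite -[X in measurable X]setTI.
    apply: continuous_measurable_Rn => //; [exact: openT| |exact: mI i].
    by move=> x _; exact: coord_continuous.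
  by apply/seteqP; split => x /= Nx i; [move=> _|]; exact: Nx.
rewrite (lebesgue_Rn_box mI) (eq_bigr (fun=> (fine (lebesgue_measure I))%:E)).
  by rewrite prodEFin ltry.
move=> i _; rewrite fineK // ge0_fin_numE //.
by rewrite /= lebesgue_measure_itv; case: ifP => _; rewrite ?ltry.
Qed.

(** The image of [K] is compact, hence bounded, and off [K] the function is zero. Continuity inside
    [U] suffices because [K] lies in [U]. *)
Lemma compact_support_ess_bounded U K f : open U -> compact K -> K `<=` U ->
  (forall x, U x -> {for x, continuous f}) ->
  (forall x, ~ K x -> f x = 0) -> ess_bounded lebesgue_Rn U f.
Proof.
move=> oU cK KU cf f0; split; first exact: continuous_measurable_Rn.
have : compact (f @` K).
  apply: continuous_compact => //; apply: continuous_in_subspaceT => x.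
  by rewrite inE => /KU; exact: cf.
(* The constant exceeds [M], and it is nonnegative, so that it also bounds the value 0 off [K]. *)
move=> /compact_bounded[M [_ /(_ (`|M| + 1))]] fM.
exists (`|M| + 1); apply: aeW => x Ux.
have [Kx|/f0 ->] := pselect (K x); last by rewrite normr0.
by apply: fM; [rewrite ltr_pwDr ?ler_norm | exists x].
Qed.

End BoundedSets.

(** * The identities in the sense of distributions *)

Section WeakForm.
Context {R : realType} {n : nat}.
Context {U : set 'rV[R]_n} (oU : open U) (bU : bounded_set U).
Context {f phi : 'rV[R]_n -> R} (Cf : C1_on U f) (tphi : test_function U phi).
Implicit Types (g psi : 'rV[R]_n -> R) (i j : 'I_n).
Implicit Types (a b eta w : 'rV[R]_n -> clifford R n).

Local Notation mu := (@lebesgue_Rn R n).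
Local Notation ebU := (ess_bounded mu U).

Let mU : measurable U := open_measurable_Rn oU.
Let finU : (mu U < +oo)%E := lebesgue_Rn_bounded U oU bU.

Let integrableU g : ebU g -> mu.-integrable U (EFin \o g) :=
  ess_bounded_integrable mu U mU finU g.

Definition cl_ess_bounded a := forall A, ebU (fun x => a x A : R).

Lemma cl_ess_boundedD a b : cl_ess_bounded a -> cl_ess_bounded b ->
  cl_ess_bounded (fun x => a x + b x).
Proof.
move=> ba bb A; have -> : (fun x => (a x + b x) A) = (fun x => a x A + b x A).
  by apply/funext => x; rewrite ffunE.
exact: ess_boundedD.
Qed.

Lemma cl_ess_bounded_conj a : cl_ess_bounded a ->
  cl_ess_bounded (fun x => clconj (a x)).
Proof.
move=> ba A.
have -> : (fun x => clconj (a x) A) = (fun x => blade_sign A A * a x A).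
  by apply/funext => x; rewrite ffunE.
by apply: ess_boundedM => //; exact: ess_bounded_cst.
Qed.

Lemma ess_bounded_cldot a b : cl_ess_bounded a -> cl_ess_bounded b ->
  ebU (fun x => cldot (a x) (b x)).
Proof. by move=> ba bb; apply: ess_bounded_sum => A; exact: ess_boundedM. Qed.

Lemma Linfty_ess_bounded a : Linfty U a -> cl_ess_bounded a.
Proof.
move=> [ma [M aM]] A; split; first exact: ma.
exists M; apply: filterS aM => x aM Ux; apply: le_trans (aM Ux).
(* One squared coefficient is at most the sum of all of them. *)
rewrite -sqrtr_sqr ler_wsqrtr // expr2 /cldot (bigD1 A) //= lerDl.
by apply: sumr_ge0 => B _; exact: sqr_ge0.
Qed.

(** Smoothness ranges over lists of directions: the empty list gives [phi] itself, a singleton a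
    first partial. *)
Let has_partials_phi x : has_partials phi x.
Proof. by have [/(_ [::] x)[]] := tphi. Qed.

Let continuous_phi x : {for x, continuous phi}.
Proof. by have [/(_ [::] x)[]] := tphi. Qed.

Let continuous_partial_phi i x : {for x, continuous (partial i phi)}.
Proof. by have [/(_ [:: i] x)[]] := tphi. Qed.

Let K := closure [set x | phi x != 0].

Let phi_out x : ~ K x -> phi x = 0.
Proof.
by move=> Kx; apply/eqP/negPn/negP => phix; apply: Kx; exact: subset_closure.
Qed.

(** The complement of [K] is open, so near [x] the function [phi] coincides with the constant 0. *)
Let partial_phi_out i x : ~ K x -> partial i phi x = 0.
Proof.
move=> Kx; rewrite /partial.
rewrite (@near_eq_derive _ _ _ (phi : _ -> R^o) (cst 0)) ?derive_cst //.
have : nbhs x (~` K).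
  by apply: open_nbhs_nbhs; split => //; exact/closed_openC/closed_closure.
by apply: filterS => y /phi_out.
Qed.

(** Used with [g] equal to [f] or a partial of [f], and [psi] equal to [phi] or a partial of [phi];
    these are the four products met below. *)
Let ebK g psi : (forall x, U x -> {for x, continuous g}) ->
  (forall x, {for x, continuous psi}) -> (forall x, ~ K x -> psi x = 0) ->
  ebU (fun x => g x * psi x).
Proof.
move=> cg cpsi psi0; have [_ cK KU] := tphi.
apply: (compact_support_ess_bounded U K _ oU cK KU) => [x Ux|x /psi0 ->].
  by apply: continuousM; [exact: cg | exact: cpsi].
by rewrite mulr0.
Qed.

Let eb_f_phi : ebU (fun x => f x * phi x).
Proof. by apply: ebK => // x /Cf[]. Qed.

Let eb_f_dphi i : ebU (fun x => f x * partial i phi x).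
Proof. by apply: ebK => // [x /Cf[]|x /partial_phi_out]. Qed.

Let eb_df_phi i : ebU (fun x => partial i f x * phi x).
Proof. by apply: ebK => // x /Cf[]. Qed.

Let eb_df_dphi i : ebU (fun x => partial i f x * partial i phi x).
Proof. by apply: ebK => // [x /Cf[]|x /partial_phi_out]. Qed.

Let partial_f_phi i : {in U, (fun x => partial i f x * phi x + f x * partial i phi x)
  =1 partial i (fun x => f x * phi x)}.
Proof. by move=> x; rewrite inE => /Cf[df _ _]; rewrite partialM. Qed.

Let eb_partial_f_phi i : ebU (partial i (fun x => f x * phi x)).
Proof. by apply: eq_ess_bounded mu U _ _ (partial_f_phi i) _; exact: ess_boundedD. Qed.

Lemma wdivVecD a b : cl_ess_bounded a -> cl_ess_bounded b ->
  wdivVec U (fun x => a x + b x) (fun x => f x * phi x)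
  = wdivVec U a (fun x => f x * phi x) + wdivVec U b (fun x => f x * phi x).
Proof.
move=> ba bb; rewrite -big_split; apply: eq_bigr => i _ /=.
rewrite /wpartial -opprD -RintegralD //; last 2 first.
- by apply/integrableU/ess_boundedM => //; exact: ba.
- by apply/integrableU/ess_boundedM => //; exact: bb.
by congr (- _); apply: eq_Rintegral => x _; rewrite /veccoef ffunE mulrDl.
Qed.

Lemma wdivVec_conj a : cl_ess_bounded a ->
  wdivVec U (fun x => clconj (a x)) (fun x => f x * phi x)
  = - wdivVec U a (fun x => f x * phi x).
Proof.
move=> ba; rewrite -sumrN; apply: eq_bigr => i _.
rewrite /wpartial; congr (- _); rewrite -mulN1r -RintegralZl //; last first.
  by apply/integrableU/ess_boundedM => //; exact: ba.
by apply: eq_Rintegral => x _; rewrite veccoef_conj mulN1r mulNr.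
Qed.

(** Attaches [phi] to [f] and to its partials, so that every term is a product of essentially
    bounded factors. *)
Let cldot_twisted_phi a eta x : cldot (a x) (twisted_grad eta f x) * phi x =
  \sum_i veccoef i (a x) * (partial i f x * phi x)
  - cldot (a x) (eta x) * (f x * phi x).
Proof.
rewrite /twisted_grad cldotDr cldotNr cldotZr cldot_grad mulrBl mulr_suml.
congr (_ - _); last by ring.
by apply: eq_bigr => i _; rewrite mulrA.
Qed.

Lemma integrable_cldot_twisted a eta : cl_ess_bounded a -> cl_ess_bounded eta ->
  mu.-integrable U (EFin \o (fun x => cldot (a x) (twisted_grad eta f x) * phi x)).
Proof.
move=> ba beta; apply: integrableU; rewrite (funext (cldot_twisted_phi a eta)).
apply: ess_boundedB; last by apply: ess_boundedM => //; exact: ess_bounded_cldot.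
by apply: ess_bounded_sum => i; apply: ess_boundedM => //; exact: ba.
Qed.

Lemma Sc_wdirac w psi : Sc (wdirac U w psi) = - wdivVec U w psi.
Proof.
rewrite Sc_sum -sumrN; apply: eq_bigr => i _.
by rewrite Sc_genM /veccoef ffunE.
Qed.

Lemma Sc_clwfun w psi : Sc (clwfun U w psi) = wfun U (fun x => Sc (w x)) psi.
Proof. by rewrite /Sc ffunE. Qed.

(** Merges the two zeroth-order integrals of the outer operator into one; linearity of the integral
    requires each to converge. *)
Lemma wfun_cldotDl a b eta : cl_ess_bounded a -> cl_ess_bounded b ->
  cl_ess_bounded eta -> let w := twisted_grad eta f in
  wfun U (fun x => cldot (a x + b x) (w x)) phi
  = wfun U (fun x => cldot (a x) (w x)) phi + wfun U (fun x => cldot (b x) (w x)) phi.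
Proof.
move=> ba bb beta w; rewrite /wfun -RintegralD //; [|exact: integrable_cldot_twisted..].
by apply: eq_Rintegral => x _; rewrite cldotDl mulrDl.
Qed.

Lemma Sc_wDCl a b eta : cl_ess_bounded a -> cl_ess_bounded b ->
  cl_ess_bounded eta -> let w := twisted_grad eta f in
  Sc (wDCl U a b w phi)
  = - wdivVec U w phi - wfun U (fun x => cldot (a x + clconj (b x)) (w x)) phi.
Proof.
move=> ba bb beta w; rewrite wfun_cldotDl //; last exact: cl_ess_bounded_conj.
rewrite /wDCl !ScD !ScN Sc_wdirac !Sc_clwfun opprD addrA.
congr (_ - _ - _); congr (wfun U _ phi); apply/funext => x; first exact: Sc_Mclconj.
by rewrite -Sc_clconjM clconjK.
Qed.

Lemma Sc_wDCr a b eta : cl_ess_bounded a -> cl_ess_bounded b ->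
  cl_ess_bounded eta -> let w := twisted_grad eta f in
  Sc (wDCr U a b w phi)
  = - wdivVec U w phi - wfun U (fun x => cldot (a x + clconj (b x)) (w x)) phi.
Proof.
move=> ba bb beta w; rewrite wfun_cldotDl //; last exact: cl_ess_bounded_conj.
rewrite /wDCr !ScD !ScN Sc_wdirac !Sc_clwfun opprD addrA.
congr (_ - _ - _); congr (wfun U _ phi); apply/funext => x.
  by rewrite Sc_clconjM cldotC.
by rewrite -Sc_clconjM clconjK.
Qed.

(** Weak counterpart of [twisted_laplacian]. Both sides reduce to the sum over [i] of
    [I1 i - I2 i - I3 i], plus [J]. *)
Lemma twisted_wlaplacian eta : cl_ess_bounded eta ->
  - wdivVec U (twisted_grad eta f) phi
  - wfun U (fun x => cldot (eta x) (twisted_grad eta f x)) phi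
  = - wlaplacian U f phi + wfun U (fun x => cldot (eta x) (eta x) * f x) phi
    + wdivVec U eta (fun x => f x * phi x).
Proof.
move=> beta.
have beta_i i : ebU (fun x => veccoef i (eta x)) by exact: beta.
have bM g i : ebU g -> mu.-integrable U (EFin \o (fun x => veccoef i (eta x) * g x)).
  by move=> bg; apply/integrableU/ess_boundedM.
pose I1 i := \int[mu]_(x in U) (partial i f x * partial i phi x).
pose I2 i := \int[mu]_(x in U) (veccoef i (eta x) * (f x * partial i phi x)).
pose I3 i := \int[mu]_(x in U) (veccoef i (eta x) * (partial i f x * phi x)).
pose J := wfun U (fun x => cldot (eta x) (eta x) * f x) phi.
have -> : wlaplacian U f phi = - \sum_i I1 i.
  by rewrite -sumrN.
have -> : wdivVec U (twisted_grad eta f) phi = - \sum_i (I1 i - I2 i).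
  rewrite -sumrN; apply: eq_bigr => i _; congr (- _).
  rewrite -RintegralB //; [|exact: integrableU|exact: bM].
  by apply: eq_Rintegral => x _; rewrite veccoef_twisted_grad; ring.
have -> : wdivVec U eta (fun x => f x * phi x) = - \sum_i (I2 i + I3 i).
  rewrite -sumrN; apply: eq_bigr => i _; congr (- _).
  rewrite -RintegralD //; [|exact: bM|exact: bM].
  (* The product rule for [f * phi], at points of [U], splits the weak divergence of [eta] into [I2]
     and [I3]. *)
  by apply: eq_Rintegral => x Ux; rewrite -(partial_f_phi i x Ux); ring.
have -> : wfun U (fun x => cldot (eta x) (twisted_grad eta f x)) phi =
    \sum_i I3 i - J.
  have bJ : ebU (fun x => cldot (eta x) (eta x) * (f x * phi x)).
    by apply: ess_boundedM => //; exact: ess_bounded_cldot.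
  have -> : J = \int[mu]_(x in U) (cldot (eta x) (eta x) * (f x * phi x)).
    by apply: eq_Rintegral => x _; rewrite mulrA.
  rewrite -Rintegral_sum // => [|i]; last exact: bM.
  rewrite -RintegralB //; last exact: integrableU.
    by apply: eq_Rintegral => x _; rewrite cldot_twisted_phi.
  by apply: integrableU; apply: ess_bounded_sum => i; exact: ess_boundedM.
by rewrite sumrB big_split /= -/J; ring.
Qed.

Lemma Sc_wDCl_twisted_grad a b : cl_ess_bounded a -> cl_ess_bounded b ->
  let eta x := a x + clconj (b x) in
  Sc (wDCl U a b (twisted_grad eta f) phi)
  = - wlaplacian U f phi + wfun U (fun x => cldot (eta x) (eta x) * f x) phi
    + wdivVec U a (fun x => f x * phi x) - wdivVec U b (fun x => f x * phi x).
Proof.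
move=> ba bb eta; have bbc := cl_ess_bounded_conj b bb.
have beta : cl_ess_bounded eta by exact: cl_ess_boundedD.
by rewrite Sc_wDCl // twisted_wlaplacian // wdivVecD // wdivVec_conj // addrA.
Qed.

Lemma Sc_wDCr_twisted_grad a b : cl_ess_bounded a -> cl_ess_bounded b ->
  let eta x := a x + clconj (b x) in
  Sc (wDCr U a b (twisted_grad eta f) phi)
  = - wlaplacian U f phi + wfun U (fun x => cldot (eta x) (eta x) * f x) phi
    + wdivVec U a (fun x => f x * phi x) - wdivVec U b (fun x => f x * phi x).
Proof.
move=> ba bb eta; have bbc := cl_ess_bounded_conj b bb.
have beta : cl_ess_bounded eta by exact: cl_ess_boundedD.
by rewrite -Sc_wDCl_twisted_grad // Sc_wDCl // Sc_wDCr.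
Qed.

End WeakForm.

(** * Both orders of composition, pointwise and weakly *)

Theorem mainTheorem6 (R : realType) (n : nat) (Omega : set 'rV[R]_n)
    (hOmega : bounded_domain Omega) (hbd : C1_boundary Omega)
    (alpha beta : 'rV[R]_n -> clifford R n)
    (halpha : Linfty Omega alpha) (hbeta : Linfty Omega beta)
    (h0 : 'rV[R]_n -> R) :
  let betabar := fun y => clconj (beta y) in
  let h0c := fun y => (h0 y)%:A : clifford R n in
  (* pointwise, wherever the derivatives involved exist *)
  (forall x, Omega x -> has_second_partials h0 x ->
     cl_has_partials alpha x -> cl_has_partials beta x ->
     - laplacian h0 x
       + (clnorm (alpha x) ^+ 2 + clnorm (beta x) ^+ 2
          + divVec alpha x - divVec beta x
          + 2 * cldot (alpha x) (betabar x)) * h0 x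
     = Sc (DCl alpha beta (DCr alpha betabar h0c) x)
     /\
     - laplacian h0 x
       + (clnorm (alpha x) ^+ 2 + clnorm (beta x) ^+ 2
          + divVec alpha x + divVec beta x
          + 2 * cldot (alpha x) (beta x)) * h0 x
     = Sc (DCr alpha betabar (DCl alpha beta h0c) x))
  /\
  (* in the sense of distributions, without differentiability of alpha, beta *)
  (C1_on Omega h0 -> forall phi, test_function Omega phi ->
     let h0phi := fun x => h0 x * phi x in
     - wlaplacian Omega h0 phi
       + wfun Omega (fun x => (clnorm (alpha x) ^+ 2 + clnorm (beta x) ^+ 2
                               + 2 * cldot (alpha x) (betabar x)) * h0 x) phi
       + wdivVec Omega alpha h0phi - wdivVec Omega beta h0phi
     = Sc (wDCl Omega alpha beta (DCr alpha betabar h0c) phi)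
     /\
     - wlaplacian Omega h0 phi
       + wfun Omega (fun x => (clnorm (alpha x) ^+ 2 + clnorm (beta x) ^+ 2
                               + 2 * cldot (alpha x) (beta x)) * h0 x) phi
       + wdivVec Omega alpha h0phi + wdivVec Omega beta h0phi
     = Sc (wDCr Omega alpha betabar (DCl alpha beta h0c) phi)).
Proof.
have [oU _ _ bU] := hOmega.
move=> betabar h0c; rewrite DCr_scalar DCl_scalar.
(* Each [eta] is written as the outer operator produces it. The inner operator of the first identity
   gives [eta1] as it stands; that of the second gives [alpha + beta], which is [eta2] after a
   double conjugation. *)
pose eta1 := fun x => alpha x + clconj (beta x).
pose eta2 := fun x => alpha x + clconj (betabar x).
have -> : (fun x => alpha x + beta x) = eta2.
  by apply/funext => x; rewrite /eta2 clconjK.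
have eta1E x : cldot (eta1 x) (eta1 x)
    = clnorm (alpha x) ^+ 2 + clnorm (beta x) ^+ 2 + 2 * cldot (alpha x) (betabar x).
  by rewrite cldotDD clnorm_conj.
have eta2E x : cldot (eta2 x) (eta2 x)
    = clnorm (alpha x) ^+ 2 + clnorm (beta x) ^+ 2 + 2 * cldot (alpha x) (beta x).
  by rewrite cldotDD clconjK.
split=> [x _ d2h dalpha dbeta|Ch phi tphi h0phi].
  have dbetabar := cl_has_partials_conj _ _ dbeta.
  have /= e1 := Sc_DCl_twisted_grad alpha beta h0 x d2h dalpha dbeta.
  have /= e2 := Sc_DCr_twisted_grad alpha betabar h0 x d2h dalpha dbetabar.
  (* In the second identity [betabar] takes the place of [beta], and its divergence is minus that of
     [beta], which restores the plus sign. *)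
  split; [rewrite [RHS]e1 eta1E|rewrite [RHS]e2 eta2E divVec_conj //]; ring.
have balpha := Linfty_ess_bounded _ halpha.
have bbeta := Linfty_ess_bounded _ hbeta.
have bbetabar := cl_ess_bounded_conj _ bbeta.
have /= e1 := Sc_wDCl_twisted_grad oU bU Ch tphi alpha beta balpha bbeta.
have /= e2 := Sc_wDCr_twisted_grad oU bU Ch tphi alpha betabar balpha bbetabar.
(* The same sign change, now for the weak divergence; what remains is the expansion of the squared
   norm of [eta] under the integral. *)
split; [rewrite [RHS]e1|rewrite [RHS]e2 (wdivVec_conj oU bU Ch tphi) // opprK];
  congr (_ + _ + _ + _); congr (wfun _ _ phi); apply/funext => x.
  by rewrite -eta1E.
by rewrite -eta2E.
Qed.
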